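(* Let $A=(a_{ij})$ be a real $n\times n$ matrix whose diagonal entries equal $1$, let $(m_i)_{i=1}^n$ be a sequence of real numbers, and let $(w_i)_{i=1}^n$ be a sequence of non-negative numbers with $\sum_{i=1}^n w_i\le 1$. Then there is a sequence $(\lambda_j)_{j=1}^n$ of real numbers with $$\sum_{j=1}^n|\lambda_j|\le 1$$ and, for each $i=1,\dots,n$, $$\left|\sum_{j=1}^n a_{ij}\lambda_j-m_i\right|\ge w_i.$$ *)

(* Defs.v *)
From mathcomp Require Import all_boot all_order all_algebra.
From mathcomp Require Import reals.

Set Implicit Arguments.
Unset Strict Implicit.
Unset Printing Implicit Defensive.

(* Main.v *)
Require Import Defs.
From mathcomp Require Import all_boot all_order all_algebra.
From mathcomp Require Import reals.
From mathcomp Require Import boolp classical_sets topology normedtype.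
From mathcomp Require Import sequences derive exp.
From mathcomp Require Import ring lra.

(** Write [B i j = A i j * sqrt (w j)], so that [B i i = sqrt (w i)].  The
    weights are split evenly between the matrix and the vector: if
    [lambda j = sqrt (w j) * y j], then [A lambda = B y], and
    [2 |lambda j| <= w j + y j ^ 2] shows that [y] in the Euclidean unit ball
    is enough for the bound on [lambda].

    Suppose that for some orthogonal [U] and some scaling [th] of the rows the
    matrix [H i j = th i * (B U) i j] is symmetric.  Bang's choice of signs
    ([Bang_signs]) then gives [nu] with [nu i = +/- th i] and
    [|(H nu) i - th i * m i| >= H i i * th i].  Dividing by [th i], the vector
    [y = U nu] satisfies [|(B y) i - m i| >= H i i]; the rows with [th i = 0]
    are those with [w i = 0], where nothing is to be proved.  So it remains to
    obtain [H i i = w i] together with [sum th i ^ 2 <= 1].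

    The first requirement dictates [th i = w i / (B U) i i], and [U] is found
    by maximizing [sum w i * ln ((B U) i i)] over the orthogonal group
    ([orthogonal_normal_form]).  For the resulting [H], right multiplication
    by an orthogonal [V] cannot increase [sum H i i * ln ((H V) i i)].
    Letting [V] be a small plane rotation forces [H] to be symmetric
    ([maximal_symmetric]); letting [V] be the reflection along an eigenvector
    with a negative eigenvalue, which would increase the diagonal, forces [H]
    to be positive semidefinite ([maximal_psd]).

    For the second requirement ([scaling_bound]), let [u i] be the rows of
    [U]; then [th i * sqrt (w i) = (H U^T) i i] is the value of the form [H]
    at the pair [(e i, u i)], so Cauchy-Schwarz bounds [th i ^ 2 * w i] by
    [w i * H(u i, u i)].  Summing, [sum th i ^ 2 <= tr (U H U^T) = tr H],
    which is [sum w i <= 1]. *)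

Import Order.TTheory GRing.Theory Num.Theory.
Import numFieldTopology.Exports numFieldNormedType.Exports.
Local Open Scope ring_scope.

(** * Compactness and maximization of weighted sums of logarithms *)

Lemma sum_continuous {R : realType} {T : topologicalType} n (f : 'I_n -> T -> R) :
  (forall i, continuous (f i)) -> continuous (fun t => \sum_(i < n) f i t).
Proof.
move=> cf; apply: continuous_big => [|i _]; last exact: cf.
by case=> a b; exact: add_continuous.
Qed.

Lemma mul_fun_continuous {R : realType} {T : topologicalType} (f g : T -> R) :
  continuous f -> continuous g -> continuous (fun t => f t * g t).
Proof. by move=> cf cg t; apply: cvgM; [exact: cf|exact: cg]. Qed.

(** The difficulty is that [ln] is unbounded below near [0].  Each [x i] is
    truncated from below at a level [d i] so small that a point where some
    truncation is active has a value below the value at [p].  The truncated sum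
    is continuous, and at its maximizer it agrees with the original one. *)
Lemma weighted_log_max {R : realType} {T : topologicalType} n (K : set T)
    (x : 'I_n -> T -> R) (w : 'I_n -> R) (p : T) :
    compact K -> (forall i, continuous (x i)) -> (forall i, 0 <= w i) ->
    K p -> (forall i, 0 < w i -> 0 < x i p) ->
  exists q, [/\ K q, forall i, 0 < w i -> 0 < x i q &
    forall r, K r -> (forall i, 0 < w i -> 0 < x i r) ->
      \sum_(i < n) w i * ln (x i r) <= \sum_(i < n) w i * ln (x i q)].
Proof.
move=> cK cx w0 Kp xp.
have K0 : (K !=set0)%classic by exists p.
have w0P i : w i = 0 \/ 0 < w i.
  by have := w0 i; rewrite le0r => /orP[/eqP|]; [left|right].
have [C C1 xC] : exists2 C : R, 1 <= C & forall i r, K r -> x i r <= C.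
  have /choice[c cP] : forall i, exists c, forall r, K r -> x i r <= x i c.
    move=> i.
    have [c cin cmax] := compact_EVT_max K0 cK (continuous_subspaceT (cx i)).
    by exists c => r Kr; apply: cmax; rewrite inE.
  exists (1 + \sum_(i < n) `|x i (c i)|).
    by rewrite lerDl sumr_ge0.
  move=> i r Kr; apply: le_trans (cP i r Kr) _.
  apply: le_trans (ler_norm _) _.
  by rewrite (bigD1 i) //= addrCA lerDl addr_ge0 // sumr_ge0.
have C0 : 0 < C by apply: lt_le_trans C1.
pose Phi r := \sum_(i < n) w i * ln (x i r).
(* For w k > 0 the choice of d gives w k * ln (d k) = - L, and L is large enough
   that - L plus the largest possible contribution of the other terms is still
   less than Phi p. *)
pose L := (\sum_(i < n) w i) * ln C + `|Phi p| + 1.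
have WC0 : 0 <= (\sum_(i < n) w i) * ln C.
  by rewrite mulr_ge0 ?sumr_ge0 ?ln_ge0.
have L0 : 0 <= L by rewrite !addr_ge0.
pose d i := expR (- (L / w i)).
have d0 i : 0 < d i by exact: expR_gt0.
have dC i : d i <= C.
  by apply: le_trans C1; rewrite -expR0 ler_expR oppr_le0 divr_ge0.
pose G r := \sum_(i < n) w i * ln (Num.max (d i) (x i r)).
have cG : continuous G.
  apply: sum_continuous => i t; apply: cvgM; first exact: cvg_cst.
  apply: continuous_cvg; first by apply: continuous_ln; rewrite lt_max d0.
  apply: (@max_fun_continuous _ _ _ (fun=> d i) (x i)) => //.
  by move=> u; exact: cvg_cst.
have PhiG r : (forall i, 0 < w i -> 0 < x i r) -> Phi r <= G r.
  move=> xr; apply: ler_sum => i _; have [->|wi] := w0P i; first by rewrite !mul0r.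
  rewrite ler_wpM2l // ler_ln ?posrE ?lt_max ?d0 //; last exact: xr.
  by rewrite le_max lexx orbT.
have [q qK qmax] := compact_EVT_max K0 cK (continuous_subspaceT cG).
have Kq : K q by rewrite inE in qK.
(* No truncation is active at the maximizer. *)
have dq i : 0 < w i -> d i <= x i q.
  move=> wi; rewrite leNgt; apply/negP => xd.
  have : Phi p <= G q by apply: le_trans (PhiG p xp) (qmax p _); rewrite inE.
  apply/negP; rewrite -ltNge /G (bigD1 i) //= max_l; last exact: ltW.
  rewrite expRK mulrN mulrC divfK ?gt_eqF //.
  have : \sum_(j < n | j != i) w j * ln (Num.max (d j) (x j q))
      <= (\sum_(j < n) w j) * ln C.
    rewrite mulr_suml [leRHS](bigD1 i) //= -[leLHS]add0r lerD //.
      by rewrite mulr_ge0 ?ln_ge0.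
    apply: ler_sum => j _; rewrite ler_wpM2l // ler_ln ?posrE ?lt_max ?d0 //.
    by rewrite ge_max dC xC.
  have := ler_norm (- Phi p); rewrite normrN /L; lra.
exists q; split=> [//|i wi|r Kr xr]; first exact: lt_le_trans (d0 i) (dq i wi).
apply: le_trans (PhiG r xr) _; apply: le_trans (qmax r _) _; first by rewrite inE.
rewrite le_eqVlt; apply/orP; left; apply/eqP; apply: eq_bigr => i _.
by have [->|wi] := w0P i; rewrite ?mul0r // max_r // dq.
Qed.

Lemma closed_in_box_compact {R : realType} n (K : set 'rV[R]_n) :
  closed K -> (forall v, K v -> forall i, `|v 0 i| <= 1) -> compact K.
Proof.
move=> Kcl K1.
apply: (subclosed_compact Kcl
  (@rV_compact R n (fun=> `[(-1), 1]%classic) _)) => [i|v Kv i /=].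
  exact: segment_compact.
by rewrite in_itv /= -ler_norml K1.
Qed.

Lemma closed_level_set {R : realType} {T : topologicalType} (f : T -> R) (c : R) :
  continuous f -> closed [set t | f t = c]%classic.
Proof.
move=> cf; apply: (preimage_closed (D := [set c]%classic)).
  by move=> t _; exact: cf.
exact: closed_eq.
Qed.

Lemma sphere_compact {R : realType} n :
  compact [set v : 'rV[R]_n | \sum_(i < n) v 0 i ^+ 2 = 1]%classic.
Proof.
apply: closed_in_box_compact => [|v /= v1 i].
  apply: closed_level_set; apply: sum_continuous => i.
  under eq_fun do rewrite expr2.
  by apply: mul_fun_continuous; exact: coord_continuous.
rewrite -(@ler_pXn2r _ 2) ?nnegrE // expr1n real_normK ?num_real // -v1.
by rewrite (bigD1 i) //= lerDl sumr_ge0 // => j _; exact: sqr_ge0.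
Qed.

Lemma orthogonal_compact {R : realType} n :
  compact [set v : 'rV[R]_(n * n) | (vec_mx v)^T *m vec_mx v = 1%:M]%classic.
Proof.
have E i j (v : 'rV[R]_(n * n)) : ((vec_mx v)^T *m vec_mx v) i j
    = \sum_(k < n) v 0 (mxvec_index k i) * v 0 (mxvec_index k j).
  by rewrite mxE; apply: eq_bigr => k _; rewrite !mxE.
apply: closed_in_box_compact => [|v /= v1 i].
  rewrite (_ : mkset _ = \bigcap_(ij in [set: 'I_n * 'I_n])
     [set v : 'rV[R]_(n * n) | \sum_(k < n) v 0 (mxvec_index k ij.1)
        * v 0 (mxvec_index k ij.2) = (1%:M : 'M[R]_n) ij.1 ij.2])%classic.
    apply: closed_bigI => -[i j] _ /=; apply: closed_level_set.
    by apply: sum_continuous => k; apply: mul_fun_continuous; exact: coord_continuous.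
  apply/seteqP; split => v /=; first by move=> v1 [i j] _ /=; rewrite -E v1.
  by move=> v1; apply/matrixP => i j; rewrite E (v1 (i, j)).
case/mxvec_indexP: i => i j.
have := E j j v; rewrite v1 mxE eqxx => e.
rewrite -(@ler_pXn2r _ 2) ?nnegrE // expr1n real_normK ?num_real //.
rewrite [leRHS]e (bigD1 i) //= expr2 lerDl sumr_ge0 // => k _.
by rewrite -expr2 sqr_ge0.
Qed.

(** * Quadratic forms *)

Definition mxform {R : realType} {n} (H : 'M[R]_n) (x y : 'rV[R]_n) : R :=
  (x *m H *m y^T) 0 0.

Lemma mxformZ {R : realType} {n} (H : 'M[R]_n) a b x y :
  mxform H (a *: x) (b *: y) = a * b * mxform H x y.
Proof.
by rewrite /mxform linearZ /= -scalemxAr -!scalemxAl scalerA mxE [b * a]mulrC.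
Qed.

Lemma mxformB_diag {R : realType} {n} (H : 'M[R]_n) (x y : 'rV[R]_n) : H^T = H ->
  mxform H (x - y) (x - y) = mxform H x x - 2 * mxform H x y + mxform H y y.
Proof.
move=> Hs; have yx : mxform H y x = mxform H x y.
  by rewrite /mxform -[y *m H *m x^T]trmxK mxE !trmx_mul trmxK Hs mulmxA.
have -> : mxform H (x - y) (x - y)
    = mxform H x x - mxform H x y - mxform H y x + mxform H y y.
  by rewrite /mxform linearB /= mulmxBr !mulmxBl !mxE; ring.
by rewrite yx; ring.
Qed.

Lemma mxform_scalar {R : realType} {n} (k : R) (x : 'rV[R]_n) :
  mxform k%:M x x = k * \sum_(i < n) x 0 i ^+ 2.
Proof.
rewrite /mxform mul_mx_scalar -scalemxAl mxE; congr (_ * _).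
by rewrite mxE; apply: eq_bigr => i _; rewrite mxE expr2.
Qed.

Lemma mxform_delta {R : realType} {n} (H : 'M[R]_n) (y : 'rV[R]_n) i :
  mxform H (delta_mx 0 i) y = \sum_(j < n) H i j * y 0 j.
Proof. by rewrite /mxform -rowE mxE; apply: eq_bigr => j _; rewrite !mxE. Qed.

Lemma psd_Cauchy_Schwarz {R : realType} {n} (H : 'M[R]_n) (x y : 'rV[R]_n) :
    H^T = H -> (forall z, 0 <= mxform H z z) ->
  mxform H x y ^+ 2 <= mxform H x x * mxform H y y.
Proof.
move=> Hs H0.
set a := mxform H x x; set b := mxform H x y; set c := mxform H y y.
have c0 : 0 <= c by exact: H0.
have P s t : 0 <= s ^+ 2 * a - 2 * (s * t * b) + t ^+ 2 * c.
  by have := H0 (s *: x - t *: y); rewrite mxformB_diag // !mxformZ -!expr2.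
have [c_eq0|c_neq0] := eqVneq c 0.
  have [->|b0] := eqVneq b 0; first by rewrite c_eq0 expr0n mulr0.
  (* For c = 0 the expression in P 1 t is affine in t, and negative at this t. *)
  have := P 1 ((a + 1) / (2 * b)); rewrite c_eq0.
  have -> : 1 ^+ 2 * a - 2 * (1 * ((a + 1) / (2 * b)) * b)
      + ((a + 1) / (2 * b)) ^+ 2 * 0 = -1 :> R by field.
  by rewrite oppr_ge0 ler10.
have cp : 0 < c by rewrite lt_def c_neq0.
have := P c b.
have -> : c ^+ 2 * a - 2 * (c * b * b) + b ^+ 2 * c = c * (a * c - b ^+ 2).
  by ring.
by rewrite pmulr_rge0 // subr_ge0.
Qed.

(** The form attains its minimum [k] on the unit sphere at some [v].  Then
    [H - k] is positive semidefinite and its form vanishes at [v], so by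
    Cauchy-Schwarz [v] lies in its kernel. *)
Lemma Rayleigh_eigenvector {R : realType} {n} (H : 'M[R]_n) (x : 'rV[R]_n) :
    H^T = H -> mxform H x x < 0 ->
  exists v k, [/\ v != 0 :> 'rV[R]_n, k < 0 & v *m H = k *: v].
Proof.
move=> Hs Hx.
pose S := [set v : 'rV[R]_n | \sum_(i < n) v 0 i ^+ 2 = 1]%classic.
have unit_vector (z : 'rV[R]_n) : z != 0 ->
    exists c, [/\ c != 0, S (c *: z) & \sum_(i < n) z 0 i ^+ 2 = c ^- 2].
  move=> z0; set s := \sum_(i < n) _.
  have sp : 0 < s.
    rewrite lt_def sumr_ge0 ?andbT; last by move=> i _; exact: sqr_ge0.
    apply: contra z0; rewrite psumr_eq0 => [/allP z0|i _]; last exact: sqr_ge0.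
    apply/eqP/rowP => i; rewrite mxE; apply/eqP.
    by have := z0 i (mem_index_enum i); rewrite /= sqrf_eq0.
  exists (Num.sqrt s)^-1; split.
  - by rewrite invr_eq0 gt_eqF // sqrtr_gt0.
  - rewrite /S /=; under eq_bigr do rewrite mxE exprMn.
    by rewrite -mulr_sumr -/s exprVn sqr_sqrtr ?mulVf ?gt_eqF // ltW.
  - by rewrite exprVn invrK sqr_sqrtr // ltW.
have x0 : x != 0.
  by apply: contraTneq Hx => ->; rewrite /mxform !mul0mx mxE ltxx.
have S0 : (S !=set0)%classic.
  by have [c [_ Sc _]] := unit_vector x x0; exists (c *: x).
have cform : continuous (fun v => mxform H v v).
  have -> : (fun v => mxform H v v) = (fun v : 'rV[R]_n =>
      \sum_(j < n) (\sum_(i < n) v 0 i * H i j) * v 0 j).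
    by apply: funext => v; rewrite /mxform mxE; apply: eq_bigr => j _; rewrite !mxE.
  apply: sum_continuous => j.
  apply: mul_fun_continuous; last exact: coord_continuous.
  apply: sum_continuous => i.
  apply: mul_fun_continuous; first exact: coord_continuous.
  exact: cst_continuous.
have [v vS vmin] :=
  compact_EVT_min S0 (@sphere_compact R n) (continuous_subspaceT cform).
rewrite inE in vS; have v1 : \sum_(i < n) v 0 i ^+ 2 = 1 := vS.
set k := mxform H v v in vmin.
have Hk (z : 'rV[R]_n) : k * \sum_(i < n) z 0 i ^+ 2 <= mxform H z z.
  have [->|z0] := eqVneq z 0.
    rewrite /mxform !mul0mx mxE big1 ?mulr0 // => i _.
    by rewrite mxE expr0n.
  have [c [c0 Sc ->]] := unit_vector z z0.
  have := vmin (c *: z); rewrite inE => /(_ Sc); rewrite mxformZ -expr2 => le.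
  by rewrite ler_pdivrMr ?exprn_even_gt0 // mulrC.
pose Q := H - k%:M.
have Qf y z : mxform Q y z = mxform H y z - mxform k%:M y z.
  by rewrite /mxform mulmxBr mulmxBl !mxE.
have Qs : Q^T = Q by rewrite /Q linearB /= Hs tr_scalar_mx.
have Qpsd z : 0 <= mxform Q z z by rewrite Qf mxform_scalar subr_ge0 Hk.
have Qv : mxform Q v v = 0 by rewrite Qf mxform_scalar v1 mulr1 subrr.
exists v, k; split.
- apply/eqP => v0; move: v1; rewrite v0 big1 => [/esym/eqP|i _].
    by rewrite oner_eq0.
  by rewrite mxE expr0n.
- rewrite ltNge; apply/negP => k0; move: Hx; apply/negP; rewrite -leNgt.
  apply: le_trans (Hk x); rewrite mulr_ge0 // sumr_ge0 // => i _.
  exact: sqr_ge0.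
- apply/eqP; rewrite -subr_eq0 -mul_mx_scalar -mulmxBr -/Q.
  apply/eqP/rowP => i; rewrite [RHS]mxE.
  have := psd_Cauchy_Schwarz Q (delta_mx 0 i) v Qs Qpsd.
  rewrite Qv mulr0 => le0.
  have : mxform Q (delta_mx 0 i) v == 0.
    by rewrite -sqrf_eq0 eq_le le0 sqr_ge0.
  rewrite mxform_delta => /eqP <-; rewrite mxE; apply: eq_bigr => j _.
  by rewrite mulrC -{1}Qs mxE.
Qed.

(** * Reflections and rotations *)

Definition reflection {R : realType} {n} (v : 'rV[R]_n) : 'M[R]_n :=
  1%:M - (2 / \sum_(i < n) v 0 i ^+ 2) *: (v^T *m v).

Lemma reflection_orthogonal {R : realType} {n} (v : 'rV[R]_n) :
  \sum_(i < n) v 0 i ^+ 2 != 0 -> (reflection v)^T *m reflection v = 1%:M.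
Proof.
rewrite /reflection; set s := \sum_(i < n) _ => s0.
have vv : v *m v^T = s%:M.
  apply/matrixP => i j; rewrite !ord1 [RHS]mxE mulr1n mxE.
  by apply: eq_bigr => k _; rewrite mxE expr2.
have PP : v^T *m v *m (v^T *m v) = s *: (v^T *m v).
  by rewrite mulmxA -(mulmxA v^T) vv mul_mx_scalar -scalemxAl.
have -> : (1%:M - 2 / s *: (v^T *m v))^T = 1%:M - 2 / s *: (v^T *m v).
  by rewrite [LHS]linearB [X in _ - X]linearZ /= trmx_mul trmxK trmx1.
rewrite mulmxBl mul1mx mulmxBr mulmx1 -scalemxAl -scalemxAr PP !scalerA.
rewrite -addrA -opprD -scalerBl -scalerDl.
have -> : 2 / s + (2 / s - 2 / s * (2 / s) * s) = 0 by field.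
by rewrite scale0r subr0.
Qed.

Lemma mulmx_reflectionE {R : realType} {n} (H : 'M[R]_n) (v : 'rV[R]_n) i j :
  (H *m reflection v) i j = H i j -
    2 / (\sum_(k < n) v 0 k ^+ 2) * (\sum_(k < n) H i k * v 0 k) * v 0 j.
Proof.
rewrite /reflection mulmxBr mulmx1 -scalemxAr mulmxA !mxE big_ord1 mxE.
rewrite mulrA; congr (_ - _ * _ * _).
by apply: eq_bigr => k _; rewrite mxE.
Qed.

Lemma ln1D_ge {R : realType} (x : R) :
  - (1 / 2) <= x -> x - 2 * x ^+ 2 <= ln (1 + x).
Proof.
move=> x2; have x1 : 0 < 1 + x by lra.
have xn : 1 + x != 0 by rewrite gt_eqF.
have /le_ln1Dx : -1 < (1 + x)^-1 - 1.
  by rewrite ltrBrDl subrr invr_gt0.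
rewrite addrC subrK lnV ?posrE // => le.
have : x - 2 * x ^+ 2 <= 1 - (1 + x)^-1; last by lra.
have -> : 1 - (1 + x)^-1 = x - 2 * x ^+ 2 + x ^+ 2 * (1 + 2 * x) / (1 + x).
  by field.
by rewrite lerDl divr_ge0 ?(ltW x1) // mulr_ge0 ?sqr_ge0 //; lra.
Qed.

(** A rotation by the angle [2 atan t] in a coordinate plane multiplies a
    diagonal entry [h] of a matrix by this fraction, where [p * h] is, up to
    sign, the other entry of the same row in that plane.  The error term is
    quadratic in [t], which is what a first-order optimality argument needs. *)
Lemma ln_rotation_ge {R : realType} (p t : R) : `|t| * (1 + 2 * `|p|) <= 1 / 2 ->
  0 < (1 - t ^+ 2 - 2 * t * p) / (1 + t ^+ 2) /\
  - (2 * t * p) - t ^+ 2 * (2 + 2 * (1 + 2 * `|p|) ^+ 2) <=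
    ln ((1 - t ^+ 2 - 2 * t * p) / (1 + t ^+ 2)).
Proof.
set M := 1 + 2 * `|p| => tM.
have p0 : 0 <= `|p| by [].
have t0 : 0 <= `|t| by [].
have M1 : 1 <= M by rewrite /M; lra.
have t1 : `|t| <= 1 by nra.
pose z := - t ^+ 2 - 2 * t * p.
have tt : t ^+ 2 = `|t| ^+ 2 by rewrite real_normK ?num_real.
have zM : `|z| <= `|t| * M.
  apply: le_trans (ler_normB _ _) _.
  by rewrite normrN normrX !normrM (ger0_norm (ler0n R 2)) /M; nra.
have z2 : - (1 / 2) <= z by have := ler_norm (- z); rewrite normrN; lra.
have zz : z ^+ 2 <= t ^+ 2 * M ^+ 2.
  have -> : z ^+ 2 = `|z| ^+ 2 by rewrite real_normK ?num_real.
  by rewrite tt -exprMn ler_pXn2r // nnegrE // mulr_ge0 //; lra.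
have -> : 1 - t ^+ 2 - 2 * t * p = 1 + z by rewrite /z; ring.
have zp : 0 < 1 + z by lra.
have t2 : 0 <= t ^+ 2 by exact: sqr_ge0.
have tp : 0 < 1 + t ^+ 2 by lra.
split; first exact: divr_gt0.
rewrite ln_div ?posrE //.
have l1 := ln1D_ge z z2.
have l2 : ln (1 + t ^+ 2) <= t ^+ 2 by apply: le_ln1Dx; lra.
have : - (2 * t * p) = z + t ^+ 2 by rewrite /z; ring.
move=> ->; nra.
Qed.

(** The vanishing of a derivative at a local maximum, without derivatives. *)
Lemma linear_le_quadratic_eq0 {R : realType} (a C d : R) : 0 < d ->
  (forall t, `|t| <= d -> a * t <= C * t ^+ 2) -> a = 0.
Proof.
move=> d0 P; apply/eqP; apply: contraT => an0.
have a0 : 0 < `|a| by rewrite normr_gt0.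
have C0 : 0 <= `|C| by [].
have D0 : 0 < d * (`|C| + 1) + `|a| by nra.
(* The choice of s makes both |a s| <= d and C s < 1 hold; t = a s then gives
   a ^ 2 s <= (C s) a ^ 2 s, a contradiction. *)
pose s := d / (d * (`|C| + 1) + `|a|).
have s0 : 0 < s by exact: divr_gt0.
have Cs : C * s < 1.
  rewrite mulrA ltr_pdivrMr // mul1r.
  by have := ler_norm C; nra.
have /P : `|a * s| <= d.
  by rewrite normrM (gtr0_norm s0) /s mulrA ler_pdivrMr //; nra.
have -> : C * (a * s) ^+ 2 = (C * s) * (a ^+ 2 * s) by ring.
have -> : a * (a * s) = a ^+ 2 * s by ring.
have : 0 < a ^+ 2 * s by rewrite mulr_gt0 // exprn_even_gt0.
nra.
Qed.

(** * Matrices whose diagonal cannot be improved by an orthogonal factor *)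

Definition log_diag_maximal {R : realType} {n} (H : 'M[R]_n) :=
  forall V : 'M[R]_n, V^T *m V = 1%:M ->
    (forall i, 0 < H i i -> 0 < (H *m V) i i) ->
  \sum_(i < n) H i i * ln ((H *m V) i i) <= \sum_(i < n) H i i * ln (H i i).

Lemma log_diag_maximal_ratio {R : realType} {n} (H V : 'M[R]_n) :
    (forall i, 0 <= H i i) -> log_diag_maximal H -> V^T *m V = 1%:M ->
    (forall i, 0 < H i i -> 0 < (H *m V) i i) ->
  \sum_(i < n) H i i * ln ((H *m V) i i / H i i) <= 0.
Proof.
move=> H0 Hmax Vo Vp.
rewrite (eq_bigr (fun i => H i i * ln ((H *m V) i i) - H i i * ln (H i i))).
  by rewrite sumrB subr_le0 Hmax.
move=> i _; have := H0 i; rewrite le0r => /orP[/eqP ->|hi].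
  by rewrite !mul0r subrr.
by rewrite ln_div ?posrE ?Vp // mulrBr.
Qed.

(** For [i != j] let [V] be a rotation in the coordinate plane of [i] and [j].
    It changes only the diagonal entries [i] and [j] of [H V], and the first
    order variation of the objective is a multiple of [H j i - H i j].  Using
    the weight [H i i] itself cancels the denominators of the logarithmic
    derivatives. *)
Lemma maximal_symmetric {R : realType} {n} (H : 'M[R]_n) :
    (forall i, 0 <= H i i) -> (forall i, H i i = 0 -> forall j, H i j = 0) ->
    log_diag_maximal H ->
  H^T = H.
Proof.
move=> H0 Hz Hmax; apply/matrixP => i j; rewrite mxE.
have [->//|ij] := eqVneq i j.
have ji : j != i by rewrite eq_sym.
(* If a diagonal entry vanishes, so does its row: the quotient, which is then 0
   by the convention for division by 0, still satisfies Hp or Hq. *)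
pose p := H i j / H i i; pose q := - (H j i / H j j).
have Hp : H i i * p = H i j.
  have [h0|h0] := eqVneq (H i i) 0; first by rewrite h0 mul0r Hz.
  by rewrite /p mulrC divfK.
have Hq : H j j * q = - H j i.
  have [h0|h0] := eqVneq (H j j) 0; first by rewrite h0 mul0r Hz ?oppr0.
  by rewrite /q mulrN mulrC divfK.
apply/eqP; rewrite -subr_eq0; apply/eqP.
pose K (r : R) := 2 + 2 * (1 + 2 * `|r|) ^+ 2.
pose d := 1 / 2 / (1 + 2 * `|p| + 2 * `|q|).
have p0 : 0 <= `|p| by []. have q0 : 0 <= `|q| by [].
have d0 : 0 < d by rewrite !divr_gt0 //; lra.
apply: (@linear_le_quadratic_eq0 _ _ ((H i i * K p + H j j * K q) / 2) d d0) => t td.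
have t0 : 0 <= `|t| by [].
have tpq : `|t| * (1 + 2 * `|p| + 2 * `|q|) <= 1 / 2.
  by rewrite -ler_pdivlMr //; lra.
have [yp0 yp] : _ := ln_rotation_ge p t ltac:(nra).
have [yq0 yq] : _ := ln_rotation_ge q t ltac:(nra).
have t2 : 0 < 1 + t ^+ 2 by have := sqr_ge0 t; lra.
pose e : 'rV[R]_n := delta_mx 0 i.
pose v : 'rV[R]_n := delta_mx 0 i + t *: delta_mx 0 j.
have sum_e (f : 'I_n -> R) : \sum_(k < n) f k * e 0 k = f i.
  rewrite (bigD1 i) //= big1 ?addr0 ?mxE ?eqxx ?mulr1 // => k ki.
  by rewrite mxE eqxx (negPf ki) mulr0.
have sum_v (f : 'I_n -> R) : \sum_(k < n) f k * v 0 k = f i + t * f j.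
  rewrite (bigD1 i) //= (bigD1 j) //= big1 ?addr0.
    rewrite !mxE !eqxx (negPf ij) (negPf ji) /=; ring.
  by move=> k /andP[ki kj]; rewrite !mxE (negPf ki) (negPf kj) /=; ring.
have ee : \sum_(k < n) e 0 k ^+ 2 = 1.
  by under eq_bigr do rewrite expr2; rewrite sum_e mxE !eqxx.
have vi : v 0 i = 1 by rewrite !mxE !eqxx (negPf ij) /=; ring.
have vj : v 0 j = t by rewrite !mxE !eqxx (negPf ji) /=; ring.
have vv : \sum_(k < n) v 0 k ^+ 2 = 1 + t ^+ 2.
  by under eq_bigr do rewrite expr2; rewrite sum_v vi vj expr2.
(* The product of the reflections along e and along e + t e_j is a rotation whose
   entries are rational in t. *)
pose V := reflection e *m reflection v.
have Vo : V^T *m V = 1%:M.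
  rewrite /V trmx_mul mulmxA -(mulmxA (reflection v)^T) reflection_orthogonal.
    by rewrite mulmx1 reflection_orthogonal // vv gt_eqF.
  by rewrite ee oner_eq0.
have HE k l : (H *m reflection e) k l = H k l - 2 * H k i * e 0 l.
  by rewrite mulmx_reflectionE ee sum_e divr1.
have HV k l : (H *m V) k l = H k l - 2 * H k i * e 0 l
    - 2 / (1 + t ^+ 2) * (- H k i + t * H k j) * v 0 l.
  rewrite /V mulmxA mulmx_reflectionE vv sum_v !HE !mxE !eqxx (negPf ji) /=.
  by congr (_ - _ * _ * _); ring.
have ei : e 0 i = 1 by rewrite mxE !eqxx.
have ej : e 0 j = 0 by rewrite mxE eqxx (negPf ji).
have HVi : (H *m V) i i = H i i * ((1 - t ^+ 2 - 2 * t * p) / (1 + t ^+ 2)).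
  rewrite HV ei vi mulrA 2!mulrBr mulr1 (_ : H i i * (2 * t * p) = 2 * t * H i j).
    by field; rewrite gt_eqF.
  by rewrite -Hp; ring.
have HVj : (H *m V) j j = H j j * ((1 - t ^+ 2 - 2 * t * q) / (1 + t ^+ 2)).
  rewrite HV ej vj mulrA 2!mulrBr mulr1 (_ : H j j * (2 * t * q) = - (2 * t * H j i)).
    by field; rewrite gt_eqF.
  by rewrite -[H j i]opprK -Hq; ring.
have HVk k : k != i -> k != j -> (H *m V) k k = H k k.
  by move=> ki kj; rewrite HV !mxE (negPf ki) (negPf kj) /=; ring.
have Vp k : 0 < H k k -> 0 < (H *m V) k k.
  have [->|ki] := eqVneq k i; first by rewrite HVi => h; exact: mulr_gt0.
  have [->|kj] := eqVneq k j; first by rewrite HVj => h; exact: mulr_gt0.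
  by rewrite HVk.
have := log_diag_maximal_ratio H V H0 Hmax Vo Vp.
rewrite (bigD1 i) //= (bigD1 j) //= big1 ?addr0; last first.
  move=> k /andP[ki kj]; rewrite HVk //.
  have [->|h0] := eqVneq (H k k) 0; first by rewrite mul0r.
  by rewrite divff // ln1 mulr0.
have cancel_diag k y : H k k * ln (H k k * y / H k k) = H k k * ln y.
  have [->|h0] := eqVneq (H k k) 0; first by rewrite !mul0r.
  by rewrite mulrAC divff // mul1r.
rewrite HVi HVj !cancel_diag => le0.
have lei := ler_wpM2l (H0 i) yp; have lej := ler_wpM2l (H0 j) yq.
have := lerD lei lej; rewrite -/(K p) -/(K q) => /le_trans/(_ le0).
have -> : H i i * (- (2 * t * p) - t ^+ 2 * K p)
    + H j j * (- (2 * t * q) - t ^+ 2 * K q)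
  = - 2 * t * (H i i * p + H j j * q) - t ^+ 2 * (H i i * K p + H j j * K q).
  by ring.
by rewrite Hp Hq; lra.
Qed.

(** Suppose [v H = k v] with [k < 0].  The reflection along [v] adds
    [- 2 k (v i) ^ 2 / |v| ^ 2 >= 0] to the diagonal entry [i], with a strict
    gain wherever [v i != 0]; this contradicts maximality. *)
Lemma maximal_psd {R : realType} {n} (H : 'M[R]_n) :
    (forall i, 0 <= H i i) -> (forall i, H i i = 0 -> forall j, H i j = 0) ->
    log_diag_maximal H ->
  forall x, 0 <= mxform H x x.
Proof.
move=> H0 Hz Hmax x; rewrite leNgt; apply/negP => Hx.
have Hs := maximal_symmetric H H0 Hz Hmax.
have [v [k [v0 k0 vH]]] := Rayleigh_eigenvector H x Hs Hx.
pose s := \sum_(i < n) v 0 i ^+ 2.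
have /existsP[l vl] : [exists l, v 0 l != 0].
  apply: contraR v0; rewrite negb_exists => /forallP v0.
  by apply/eqP/rowP => i; rewrite mxE; apply/eqP; have := v0 i; rewrite negbK.
have sp : 0 < s.
  rewrite /s (bigD1 l) //= ltr_pwDl ?exprn_even_gt0 //.
  by rewrite sumr_ge0 // => i _; exact: sqr_ge0.
have Hv i : \sum_(j < n) H i j * v 0 j = k * v 0 i.
  have := congr1 (fun u : 'rV[R]_n => u 0 i) vH; rewrite !mxE => <-.
  by apply: eq_bigr => j _; rewrite -{1}Hs mxE mulrC.
have HV i : (H *m reflection v) i i = H i i + - k * (2 / s * v 0 i ^+ 2).
  by rewrite mulmx_reflectionE Hv -/s; ring.
have gain i : 0 <= - k * (2 / s * v 0 i ^+ 2).
  by rewrite mulr_ge0 ?oppr_ge0 ?(ltW k0) // mulr_ge0 ?divr_ge0 ?(ltW sp) ?sqr_ge0.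
(* The gain at l only counts if the weight H l l is positive; otherwise row l of H
   vanishes and the eigenvector equation gives v l = 0. *)
have hl : 0 < H l l.
  rewrite lt_def H0 andbT; apply/eqP => h0.
  have /eqP := Hv l; rewrite big1 => [|j _]; last by rewrite Hz ?mul0r.
  by rewrite eq_sym mulf_eq0 (negPf vl) lt_eqF.
have gainl : 0 < - k * (2 / s * v 0 l ^+ 2).
  by rewrite mulr_gt0 ?oppr_gt0 // mulr_gt0 ?divr_gt0 ?exprn_even_gt0.
have Vp i : 0 < H i i -> 0 < (H *m reflection v) i i.
  by rewrite HV => hi; exact: ltr_pwDl.
have := Hmax (reflection v) (reflection_orthogonal v (lt0r_neq0 sp)) Vp.
apply/negP; rewrite -ltNge [ltRHS](bigD1 l) //= [ltLHS](bigD1 l) //=.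
apply: ltr_leD.
  by rewrite ltr_pM2l // ltr_ln ?posrE ?Vp // HV ltrDl.
apply: ler_sum => i _; have := H0 i; rewrite le0r => /orP[/eqP ->|hi].
  by rewrite !mul0r.
by rewrite ler_pM2l // ler_ln ?posrE ?Vp // HV lerDl.
Qed.

(** * The optimal orthogonal factor *)

(** Take [U] maximizing [sum w i * ln ((B U) i i)] and [th i = w i / (B U) i i].
    Since [ln (th i * y) = ln (th i) + ln y], the scaling shifts the objective
    by a constant, so the maximality of [U] says that no orthogonal [V] improves
    [H].  When [w i = 0] this gives [th i = 0], hence a zero row of [H], which
    is consistent with the term [i] being absent from the objective. *)
Lemma orthogonal_normal_form {R : realType} {n} (B : 'M[R]_n) (w : 'I_n -> R) :
    (forall i, 0 <= w i) -> (forall i, B i i = Num.sqrt (w i)) ->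
  exists (U : 'M[R]_n) (th : 'I_n -> R),
    let H := \matrix_(i, j) (th i * (B *m U) i j) in
    [/\ U^T *m U = 1%:M,
        forall i, 0 <= th i /\ (th i = 0 <-> w i = 0),
        forall i, H i i = w i,
        H^T = H & forall x, 0 <= mxform H x x].
Proof.
move=> w0 Bd.
pose x i (u : 'rV[R]_(n * n)) := (B *m vec_mx u) i i.
have cx i : continuous (x i).
  have -> : x i = fun u => \sum_(k < n) B i k * u 0 (mxvec_index k i).
    by apply: funext => u; rewrite /x mxE; apply: eq_bigr => k _; rewrite mxE.
  apply: sum_continuous => k; apply: mul_fun_continuous; first exact: cst_continuous.
  exact: coord_continuous.
have [||u [uo up umax]] := weighted_log_max n _ x w (mxvec 1%:M)
  (@orthogonal_compact R n) cx w0.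
- by rewrite /= mxvecK trmx1 mulmx1.
- by move=> i wi; rewrite /x mxvecK mulmx1 Bd sqrtr_gt0.
pose U := vec_mx u; pose th i := w i / (B *m U) i i.
have Uo : U^T *m U = 1%:M := uo.
have w0P i : w i = 0 \/ 0 < w i.
  by have := w0 i; rewrite le0r => /orP[/eqP|]; [left|right].
exists U, th => H.
have thp i : 0 < w i -> 0 < th i.
  by move=> wi; rewrite divr_gt0 //; exact: up.
have th0 i : w i = 0 -> th i = 0 by rewrite /th => ->; rewrite mul0r.
have Hd i : H i i = w i.
  rewrite mxE; have [wi|wi] := w0P i; first by rewrite th0 // mul0r.
  by rewrite /th divfK // gt_eqF //; exact: up.
have Hp i : 0 <= H i i by rewrite Hd.
have Hz i : H i i = 0 -> forall j, H i j = 0.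
  by rewrite Hd => wi j; rewrite mxE th0 // mul0r.
have HV V i : (H *m V) i i = th i * (B *m (U *m V)) i i.
  rewrite mulmxA [in RHS]mxE mulr_sumr mxE; apply: eq_bigr => j _.
  by rewrite [H i j]mxE mulrA.
have Hmax : log_diag_maximal H.
  move=> V Vo Vp.
  have xV i : x i (mxvec (U *m V)) = (B *m (U *m V)) i i by rewrite /x mxvecK.
  have xVp i : 0 < w i -> 0 < x i (mxvec (U *m V)).
    move=> wi; have := Vp i; rewrite Hd => /(_ wi).
    by rewrite HV xV pmulr_rgt0 // thp.
  have := umax (mxvec (U *m V)); rewrite /= mxvecK trmx_mul mulmxA.
  rewrite -(mulmxA V^T) Uo mulmx1 => /(_ Vo xVp) le.
  rewrite -subr_ge0 -sumrB.
  rewrite -subr_ge0 -sumrB in le.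
  apply: le_trans le _; rewrite le_eqVlt; apply/orP; left; apply/eqP.
  apply: eq_bigr => i _; rewrite Hd; have [->|wi] := w0P i.
    by rewrite !mul0r.
  have lnth y : 0 < y -> ln (th i * y) = ln (th i) + ln y.
    by move=> y0; rewrite lnM ?posrE //; exact: thp.
  have -> : ln (w i) = ln (th i) + ln (x i u).
    by rewrite -[w i]Hd mxE lnth //; exact: up.
  rewrite HV -xV lnth ?xVp //; ring.
split=> //.
- move=> i; have [wi|wi] := w0P i; first by rewrite th0 // wi.
  have ti := thp i wi; split; first exact: ltW.
  by split=> e; [move: ti|move: wi]; rewrite e ltxx.
- exact: maximal_symmetric.
- exact: maximal_psd.
Qed.

(** * Bang's lemma and the theorem *)

(** Among all vectors [x] with [x i = +/- c i], take one maximizing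
    [H(x, x) - 2 sum x i * M i].  Flipping the sign of [x k] changes this by
    [4 x k ^ 2 H k k - 4 x k ((H x) k - M k)], which is therefore nonpositive. *)
Lemma Bang_signs {R : realType} {n} (H : 'M[R]_n) (c M : 'I_n -> R) :
    H^T = H -> (forall i, 0 <= c i) ->
  exists nu : 'I_n -> R, (forall i, nu i ^+ 2 = c i ^+ 2) /\
    forall i, H i i * c i <= `|\sum_(j < n) H i j * nu j - M i|.
Proof.
move=> Hs c0.
pose x (e : {ffun 'I_n -> bool}) i := (-1) ^+ e i * c i.
pose row_of e : 'rV[R]_n := \row_i x e i.
pose F e := mxform H (row_of e) (row_of e) - 2 * \sum_(i < n) x e i * M i.
have [e emax] : exists e, forall e', F e' <= F e.
  case: (arg_maxP F (erefl : xpredT [ffun=> false])) => e _ emax.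
  by exists e => e'; exact: emax.
exists (x e); split=> [i|k].
  by rewrite exprMn sqrr_sign mul1r.
pose e' := [ffun i => if i == k then ~~ e k else e i].
have xe' i : x e' i = x e i - 2 * (i == k)%:R * x e k.
  rewrite /x /e' ffunE; have [->|_] := eqVneq i k; last by rewrite /=; ring.
  by case: (e k); rewrite /= ?expr1 ?expr0; ring.
have re' : row_of e' = row_of e - (2 * x e k) *: delta_mx 0 k.
  by apply/rowP => i; rewrite !mxE xe' eqxx /=; ring.
set S := \sum_(j < n) H k j * x e j.
have := emax e'; rewrite /F re' mxformB_diag //.
have -> : mxform H (row_of e) ((2 * x e k) *: delta_mx 0 k) = 2 * x e k * S.
  rewrite -[row_of e]scale1r mxformZ mul1r; congr (_ * _).
  rewrite /mxform -[_ *m H *m _]trmxK mxE !trmx_mul trmxK Hs mulmxA.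
  by rewrite -/(mxform H _ _) mxform_delta; apply: eq_bigr => j _; rewrite mxE.
have -> : mxform H ((2 * x e k) *: delta_mx 0 k) ((2 * x e k) *: delta_mx 0 k)
    = (2 * x e k) ^+ 2 * H k k.
  rewrite mxformZ -expr2 mxform_delta (bigD1 k) //= big1 => [|j jk].
    by rewrite mxE !eqxx mulr1 addr0.
  by rewrite mxE eqxx (negPf jk) mulr0.
have -> : \sum_(i < n) x e' i * M i = \sum_(i < n) x e i * M i - 2 * x e k * M k.
  rewrite (bigD1 k) //= [X in _ = X - _](bigD1 k) //= xe' eqxx.
  rewrite [X in _ + X](eq_bigr (fun i => x e i * M i)) => [|i ik].
    by rewrite /=; ring.
  by rewrite xe' (negPf ik) /=; ring.
move=> le.
have xx : x e k ^+ 2 = c k ^+ 2 by rewrite exprMn sqrr_sign mul1r.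
have xS : c k ^+ 2 * H k k <= x e k * (S - M k) by rewrite -xx; lra.
have := c0 k; rewrite le0r => /orP[/eqP ->|ck]; first by rewrite mulr0.
rewrite -(ler_pM2l ck) mulrCA -expr2 mulrC; apply: le_trans xS _.
apply: le_trans (ler_norm _) _; rewrite normrM.
by rewrite /x normrM normr_sign mul1r (gtr0_norm ck).
Qed.

(** Since row [i] of [H U^T] is [th i] times row [i] of [B], the known diagonal
    of [B] expresses [th i] through the form [H] at a coordinate vector and a
    row of [U]; Cauchy-Schwarz then bounds [th i ^ 2] by a diagonal entry of
    [U H U^T], whose trace is [tr H]. *)
Lemma scaling_bound {R : realType} {n} (B U : 'M[R]_n) (w th : 'I_n -> R) :
    let H := \matrix_(i, j) (th i * (B *m U) i j) in
    U^T *m U = 1%:M -> (forall i, 0 <= w i) ->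
    (forall i, w i = 0 -> th i = 0) ->
    (forall i, B i i = Num.sqrt (w i)) -> (forall i, H i i = w i) ->
    H^T = H -> (forall x, 0 <= mxform H x x) ->
  \sum_(i < n) th i ^+ 2 <= \sum_(i < n) w i.
Proof.
move=> H Uo w0 th0 Bd Hd Hs Hpsd.
have Uo' : U *m U^T = 1%:M by exact: mulmx1C.
have HU i : th i * Num.sqrt (w i) = mxform H (delta_mx 0 i) (row i U).
  rewrite mxform_delta -Bd -[B in LHS]mulmx1 -Uo' mulmxA mxE mulr_sumr.
  by apply: eq_bigr => j _; rewrite !mxE mulrA.
have tr : \sum_(i < n) w i = \sum_(i < n) mxform H (row i U) (row i U).
  have -> : \sum_(i < n) w i = \tr H by apply: eq_bigr => i _; rewrite Hd.
  rewrite -[H in LHS]mulmx1 -Uo mulmxA mxtrace_mulC mulmxA; apply: eq_bigr => i _.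
  by rewrite /mxform -row_mul !mxE; apply: eq_bigr => j _; rewrite !mxE.
rewrite tr; apply: ler_sum => i _.
have := w0 i; rewrite le0r => /orP[/eqP/th0 ->|wi]; first by rewrite expr0n.
rewrite -(ler_pM2r wi) -{1}(sqr_sqrtr (ltW wi)) -exprMn HU mulrC.
have := psd_Cauchy_Schwarz H (delta_mx 0 i) (row i U) Hs Hpsd.
rewrite [X in _ <= X * _]mxform_delta (bigD1 i) //= big1 => [|j ji].
  by rewrite Hd mxE !eqxx mulr1 addr0.
by rewrite [X in _ * X]mxE eqxx (negPf ji) mulr0.
Qed.

Theorem mainTheorem4 (R : realType) (n : nat) (A : 'M[R]_n)
    (m w : 'I_n -> R)
    (hA : forall i : 'I_n, A i i = 1)
    (hw : forall i : 'I_n, 0 <= w i)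
    (hsum : \sum_(i < n) w i <= 1) :
  exists lambda : 'I_n -> R,
    \sum_(j < n) `|lambda j| <= 1 /\
    forall i : 'I_n, w i <= `|\sum_(j < n) A i j * lambda j - m i|.
Proof.
pose B : 'M[R]_n := \matrix_(i, j) (A i j * Num.sqrt (w j)).
have Bd i : B i i = Num.sqrt (w i) by rewrite mxE hA mul1r.
have [U [th]] := orthogonal_normal_form B w hw Bd.
set H := \matrix_(i, j) _ => -[Uo th0 Hd Hs Hpsd].
have thz i : w i = 0 -> th i = 0 by case: (th0 i) => _ [].
have tha i : 0 <= th i by case: (th0 i).
have th1 : \sum_(i < n) th i ^+ 2 <= 1.
  by apply: le_trans hsum; exact: (@scaling_bound _ _ B U).
have [nu [nu2 nuM]] := Bang_signs H th (fun i => th i * m i) Hs tha.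
pose y k := \sum_(j < n) U k j * nu j.
(* U is orthogonal, hence preserves the Euclidean norm. *)
have y2 : \sum_(k < n) y k ^+ 2 = \sum_(i < n) th i ^+ 2.
  pose v : 'cV[R]_n := \col_j nu j.
  have yE k : y k = (U *m v) k 0 by rewrite mxE; apply: eq_bigr => j _; rewrite mxE.
  have sq (u : 'cV[R]_n) : \sum_(k < n) u k 0 ^+ 2 = (u^T *m u) 0 0.
    by rewrite mxE; apply: eq_bigr => k _; rewrite mxE expr2.
  under eq_bigr do rewrite yE.
  rewrite sq trmx_mul mulmxA -(mulmxA v^T) Uo mulmx1 -sq.
  by apply: eq_bigr => j _; rewrite mxE nu2.
exists (fun k => Num.sqrt (w k) * y k); split=> [|i].
  apply: (@le_trans _ _ (\sum_(k < n) (w k + y k ^+ 2) / 2)).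
    apply: ler_sum => k _; rewrite normrM (ger0_norm (sqrtr_ge0 _)).
    have := sqr_ge0 (Num.sqrt (w k) - `|y k|).
    by rewrite sqrrB sqr_sqrtr // real_normK ?num_real //; lra.
  by rewrite -mulr_suml big_split /= y2; lra.
have -> : \sum_(j < n) A i j * (Num.sqrt (w j) * y j)
    = \sum_(j < n) (B *m U) i j * nu j.
  under [RHS]eq_bigr do rewrite mxE mulr_suml.
  rewrite exchange_big /=; apply: eq_bigr => k _.
  by rewrite mulrA /y mulr_sumr; apply: eq_bigr => j _; rewrite !mxE mulrA.
have [wi|wi] := eqVneq (w i) 0; first by rewrite wi.
have ti : 0 < th i.
  by rewrite lt_def tha andbT; apply: contra_neq wi; case: (th0 i) => _ [].
rewrite -(ler_pM2l ti) -[X in X * `|_|](gtr0_norm ti) -normrM mulrBr mulr_sumr.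
have := nuM i; rewrite Hd mulrC; congr (_ <= `|_ - _|).
by apply: eq_bigr => j _; rewrite mxE mulrA.
Qed.
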